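(* Let $\Delta$ be a boolean complex of dimension $n-1$ and $\Bbbk$ a field. Let $\lambda_1,\lambda_2\in\mathscr{P}_n$, and let $f_1\in\Bbbk[\Delta]_{\lambda_1}$ and $f_2\in\Bbbk[\Delta]_{\lambda_2}$. Then $$f_1f_2\in\bigoplus_{\mu\trianglelefteq\lambda_1+\lambda_2}\Bbbk[\Delta]_\mu .$$
   Context: Boolean complexes. A boolean complex $\Delta$ is a finite regular CW complex in which every cell is a simplex with its standard CW structure, the attaching maps sending cells homeomorphically to cells. $P(\Delta)$ is the poset of cells (faces), with $\alpha\preceq\beta$ iff $\alpha$ lies in the closure of $\beta$; $\widehat P(\Delta)=P(\Delta)\cup\{\varnothing\}$ with $\varnothing$ an adjoined minimum. Combinatorially $\Delta$ amounts to the finite poset $\widehat P(\Delta)$, which has a minimum and in which every lower interval is a boolean lattice. $\operatorname{rk}(\alpha)=\dim\alpha+1$ is the rank in $\widehat P(\Delta)$. Ring. $\Bbbk[\Delta]$ is the quotient of $\Bbbk[x_\alpha:\alpha\in\widehat P(\Delta)]$ by the ideal generated by: $x_\varnothing-1$; $x_\alpha x_\beta$ for $\alpha,\beta$ with no common upper bound; and $x_\alpha x_\beta-x_{\alpha\wedge\beta}\sum_\gamma x_\gamma$ for $\alpha,\beta$ with a common upper bound, summing over all minimal common upper bounds $\gamma$. A standard monomial is a monomial in the $x_\alpha$ ($\alpha\in P(\Delta)$) supported on a chain of $P(\Delta)$; standard monomials form a $\Bbbk$-basis of $\Bbbk[\Delta]$. Shape. $\mathscr{P}_n$ is the monoid of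 partitions with at most $n$ parts under componentwise addition (zero-padding); $(1^j)$ is the partition with $j$ parts equal to $1$. The shape of a standard monomial $\prod_\alpha x_\alpha^{c_\alpha}$ is $\sum_\alpha c_\alpha(1^{\operatorname{rk}(\alpha)})\in\mathscr{P}_n$. $\Bbbk[\Delta]_\lambda$ is the $\Bbbk$-span of the standard monomials of shape $\lambda$. Dominance. For partitions $\lambda,\mu$ of the same natural number, $\mu\trianglelefteq\lambda$ means $\mu_1+\dots+\mu_j\le\lambda_1+\dots+\lambda_j$ for all $j$. *)

(* Defs.v *)
From HB Require Import structures.
From mathcomp Require Import all_boot all_order all_algebra.
From mathcomp Require Import ring_quotient.
From mathcomp Require Import boolp.
From mathcomp.multinomials Require Import mpoly.

Set Implicit Arguments.
Unset Strict Implicit.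
Unset Printing Implicit Defensive.

Import Order.TTheory GRing.Theory.
Local Open Scope ring_scope.

(* Partitions with at most n parts: zero-padded nonincreasing n-vectors, with
   the pointwise addition of {ffun 'I_n -> nat}; the part lambda_(j+1) is l j. *)
Definition is_partition (n : nat) : {pred {ffun 'I_n -> nat}} :=
  fun l => [forall i : 'I_n, forall j : 'I_n, (i <= j)%N ==> (l j <= l i)%N].

Lemma is_partition_closed n : GRing.nmod_closed (@is_partition n).
Proof.
split=> [|l m /forallP hl /forallP hm].
  by apply/forallP=> i; apply/forallP=> j; rewrite !ffunE leqnn implybT.
apply/forallP=> i; apply/forallP=> j; apply/implyP=> ij; rewrite !ffunE.
apply: leq_add; first exact: (implyP (forallP (hl i) j) ij).
exact: (implyP (forallP (hm i) j) ij).
Qed.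

HB.instance Definition _ n :=
  GRing.isAddClosed.Build {ffun 'I_n -> nat} (@is_partition n)
    (is_partition_closed n).

Record partition_le (n : nat) := PartitionLe {
  parts :> {ffun 'I_n -> nat};
  parts_partition : is_partition parts
}.

HB.instance Definition _ n := [isSub for @parts n].
HB.instance Definition _ n := [Choice of partition_le n by <:].
HB.instance Definition _ n :=
  GRing.SubChoice_isSubNmodule.Build {ffun 'I_n -> nat} (@is_partition n)
    (partition_le n) (is_partition_closed n).

Lemma column_subproof (n j : nat) :
  is_partition [ffun i : 'I_n => ((i < j)%N : nat)].
Proof.
apply/forallP=> i; apply/forallP=> i'; apply/implyP=> ii'; rewrite !ffunE.
by case: (ltnP i' j) => // i'j; rewrite (leq_ltn_trans ii' i'j).
Qed.

(* The partition (1^j), for j <= n. *)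
Definition column (n j : nat) : partition_le n :=
  PartitionLe (column_subproof n j).

Definition dominated (n : nat) (m l : partition_le n) : bool :=
  (\sum_(i < n) m i == \sum_(i < n) l i)%N &&
  [forall j : 'I_n,
     (\sum_(i < n | (i <= j)%N) m i <= \sum_(i < n | (i <= j)%N) l i)%N].

(* A finite poset P with minimum \bot stands for the face poset with the empty
   face adjoined; the faces of the complex itself are the a != \bot. *)
Section Complex.
Variables (d : Order.disp_t) (P : finBPOrderType d).
Local Open Scope order_scope.

Definition boolean_complex : Prop :=
  forall a : P, exists (r : nat) (f : {set 'I_r} -> P),
    (forall X Y, (f X <= f Y) = (X \subset Y)) /\
    (forall b, b <= a <-> exists X, f X = b).

Definition is_chain (C : {set P}) : bool :=
  [forall a in C, forall b in C, a >=< b].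

(* The largest number of steps of a chain from \bot up to a. *)
Definition rk (a : P) : nat :=
  (\max_(C : {set P} | is_chain C && [forall b in C, (b < a)%O]) #|C|)%N.

Definition face_dim (a : P) : int := ((rk a)%:Z - 1)%R.

(* The dimension is -1 when the complex has only the empty face. *)
Definition complex_dim : int := \big[Order.max/face_dim \bot]_(a : P) face_dim a.

Definition common_ub (a b c : P) : bool := (a <= c) && (b <= c).

Definition min_common_ub (a b c : P) : bool :=
  common_ub a b c &&
  [forall c' : P, common_ub a b c' && (c' <= c) ==> (c' == c)].

Definition is_meet (a b m : P) : bool :=
  (m <= a) && (m <= b) &&
  [forall m' : P, (m' <= a) && (m' <= b) ==> (m' <= m)].

End Complex.

Definition generated_ideal (R : comNzRingType) (G : R -> Prop) (p : R) : Prop :=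
  exists s : seq (R * R),
    (forall u, u \in s -> G u.2) /\ p = \sum_(u <- s) u.1 * u.2.

Section FaceRing.
Variables (k : fieldType) (d : Order.disp_t) (P : finBPOrderType d).

Definition face_var (a : P) : {mpoly k[#|P|]} := 'X_(enum_rank a).

Definition face_relation (p : {mpoly k[#|P|]}) : Prop :=
  [\/ p = face_var \bot%O - 1,
      exists a b : P,
        (forall c, ~~ common_ub a b c) /\ p = face_var a * face_var b
    | exists a b m : P,
        [/\ exists c, common_ub a b c, is_meet a b m &
          p = face_var a * face_var b -
              face_var m * \sum_(c | min_common_ub a b c) face_var c] ].

Definition face_ideal : {pred {mpoly k[#|P|]}} :=
  fun p => `[< generated_ideal face_relation p >].

(* Evaluation at the origin of the hyperplane x_\bot = 1 kills the relations. *)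
Definition bot_point (i : 'I_#|P|) : k := (enum_val i == \bot%O :> P)%:R.

Lemma bot_point_var (a : P) : (face_var a).@[bot_point] = (a == \bot%O)%:R.
Proof. by rewrite mevalXU /bot_point enum_rankK. Qed.

Lemma face_relation_bot_point p : face_relation p -> p.@[bot_point] = 0.
Proof.
case=> [->|[a [b [nub ->]]]|[a [b [m [_ /andP[/andP[ma mb] /forallP hm] ->]]]]].
- by rewrite mevalB meval1 bot_point_var eqxx subrr.
- rewrite mevalM !bot_point_var; case: eqVneq => [ea|]; last by rewrite mul0r.
  by have := nub b; rewrite /common_ub ea Order.POrderTheory.lexx le0x.
rewrite mevalB !mevalM raddf_sum /= !bot_point_var.
under eq_bigr do rewrite bot_point_var.
have sum_dom (a' b' : P) (hb : b' = \bot%O) :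
    \sum_(c | min_common_ub a' b' c) ((c == \bot%O)%:R : k) = (a' == \bot%O)%:R.
  rewrite (bigD1 a') /=; last first.
    rewrite /min_common_ub /common_ub hb le0x lexx /=.
    apply/forallP=> c; apply/implyP=> /andP[/andP[ac _] ca].
    by rewrite eq_le ca ac.
  rewrite big1 ?addr0 // => c /andP[/andP[/andP[ac _] /forallP /(_ a')]].
  by rewrite /common_ub hb lexx le0x ac /= => /eqP->; rewrite eqxx.
have mcubC (a' b' c : P) : min_common_ub a' b' c = min_common_ub b' a' c.
  rewrite /min_common_ub /common_ub [(a' <= c)%O && _]andbC; congr (_ && _).
  by apply: eq_forallb => c'; rewrite [(a' <= c')%O && _]andbC.
have m0 : (a == \bot%O) || (b == \bot%O) -> m = \bot%O.
  by case/orP=> /eqP e; apply/eqP; rewrite -lex0 -?e // -e.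
case: (eqVneq b \bot%O) => [eb|b0].
  by rewrite sum_dom // m0 ?eb ?eqxx ?orbT // mulr1 mul1r subrr.
case: (eqVneq a \bot%O) => [ea|a0].
  rewrite (eq_bigl _ _ (mcubC a b)) sum_dom // m0 ?ea ?eqxx //.
  by rewrite (negbTE b0) !mulr0 subrr.
rewrite mul0r big1 ?mulr0 ?subrr // => c /andP[/andP[ac _] _].
by case: eqVneq => // c0; move: ac; rewrite c0 lex0 (negbTE a0).
Qed.

Lemma face_ideal_closed : idealr_closed face_ideal.
Proof.
split=> [||a u v].
- by apply/asboolP; exists [::]; split=> //; rewrite big_nil.
- apply/asboolP=> -[s [hs /(congr1 (meval bot_point))]].
  rewrite meval1 raddf_sum big_seq big1 => [/eqP|u us].
    by rewrite oner_eq0.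
  by rewrite /= mevalM (face_relation_bot_point (hs u us)) mulr0.
move=> /asboolP[s [hs ->]] /asboolP[t [ht ->]]; apply/asboolP.
exists ([seq (a * w.1, w.2) | w <- s] ++ t); split=> [w|].
  by rewrite mem_cat => /orP[/mapP[w' /hs ? ->]|/ht].
rewrite big_cat big_map mulr_sumr; congr (_ + _).
  by apply: eq_bigr => w _; apply: mulrA.
Qed.

HB.instance Definition _ :=
  isIdealr.Build {mpoly k[#|P|]} face_ideal face_ideal_closed.

Definition face_ring : Type := {ideal_quot face_ideal}.

HB.instance Definition _ := GRing.ComNzRing.on face_ring.

Definition face_class (p : {mpoly k[#|P|]}) : face_ring :=
  (\pi_({ideal_quot face_ideal}) p)%qT.

Lemma face_class_zmod_morphism : zmod_morphism face_class.
Proof. by move=> p q; rewrite /face_class raddfB. Qed.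

HB.instance Definition _ :=
  GRing.isZmodMorphism.Build {mpoly k[#|P|]} face_ring face_class
    face_class_zmod_morphism.

Lemma face_class_monoid_morphism : monoid_morphism face_class.
Proof. by split=> [|p q]; rewrite /face_class ?rmorph1 ?rmorphM. Qed.

HB.instance Definition _ :=
  GRing.isMonoidMorphism.Build {mpoly k[#|P|]} face_ring face_class
    face_class_monoid_morphism.

Definition face_scale (c : k) (f : face_ring) : face_ring :=
  face_class c%:MP * f.

Lemma face_scaleA c e f : face_scale c (face_scale e f) = face_scale (c * e) f.
Proof. by rewrite /face_scale mulrA mpolyCM rmorphM. Qed.

Lemma face_scale1 : left_id 1 face_scale.
Proof. by move=> f; rewrite /face_scale rmorph1 mul1r. Qed.

Lemma face_scaleDr : right_distributive face_scale +%R.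
Proof. by move=> c f g; rewrite /face_scale mulrDr. Qed.

Lemma face_scaleDl f : {morph face_scale^~ f : c e / c + e}.
Proof. by move=> c e; rewrite /face_scale mpolyCD rmorphD mulrDl. Qed.

HB.instance Definition _ :=
  GRing.Zmodule_isLmodule.Build k face_ring
    face_scaleA face_scale1 face_scaleDr face_scaleDl.

Lemma face_scaleAl (c : k) (f g : face_ring) : c *: (f * g) = c *: f * g.
Proof. exact: mulrA. Qed.

HB.instance Definition _ :=
  GRing.Lmodule_isLalgebra.Build k face_ring face_scaleAl.

(* The exponent vector c encodes the monomial \prod_a x_a ^+ c a; the variable
   x_\bot is excluded from standard monomials. *)
Definition standard (c : {ffun P -> nat}) : bool :=
  (c \bot%O == 0)%N && is_chain [set a | c a != 0%N].

Definition monomial (c : {ffun P -> nat}) : face_ring :=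
  face_class (\prod_(a : P) face_var a ^+ c a).

Definition shape (n : nat) (c : {ffun P -> nat}) : partition_le n :=
  \sum_(a : P | a != \bot%O) column n (rk a) *+ c a.

(* The k-span of the standard monomials of shape l. *)
Definition shape_component (n : nat) (l : partition_le n) (f : face_ring)
    : Prop :=
  exists (s : seq {ffun P -> nat}) (a : {ffun P -> nat} -> k),
    (forall c, c \in s -> standard c /\ shape n c = l) /\
    f = \sum_(c <- s) a c *: monomial c.

End FaceRing.

(* Membership in the internal sum of the W i over the indices i satisfying A. *)
Definition in_sum (I : eqType) (V : zmodType) (A : pred I)
    (W : I -> V -> Prop) (v : V) : Prop :=
  exists (s : seq I) (g : I -> V),
    [/\ uniq s, (forall i, i \in s -> A i /\ W i (g i)) &
        v = \sum_(i <- s) g i].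

(* Main.v *)
Require Import Defs.
From mathcomp Require Import all_boot all_order all_algebra.
From mathcomp Require Import ring_quotient boolp zify.
From mathcomp.multinomials Require Import mpoly.
Import Order.TTheory GRing.Theory.
Local Open Scope ring_scope.

Set Implicit Arguments.
Unset Strict Implicit.
Unset Printing Implicit Defensive.

(** Every product of standard monomials is a monomial in the face variables, and
    shapes of monomials add, so it suffices to expand one arbitrary monomial in
    standard monomials whose shapes its own shape dominates.

    If two faces a and b of the monomial are incomparable, the defining relation
    replaces x_a x_b by the sum of the x_m x_u, where m is the meet of a and b
    and u runs over their minimal common upper bounds, or by 0 when there is no
    common upper bound. Inside the interval below u, which is a boolean lattice,
    u is the join of a and b, so rk m + rk u = rk a + rk b with rk m below and
    rk u above both rk a and rk b (rk_modular). Two consequences carry the proof.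

    The shape goes down in dominance order: the sum of the first j parts of
    (1^r) is min(r, j), a concave function of r, and (rk m, rk u) is a spread of
    (rk a, rk b) with the same sum (dominated_columns).

    The rewriting terminates: r * (n - r) is strictly concave in r and
    nonnegative for ranks at most n, so the sum of these quantities over the
    faces of the monomial strictly drops (height_defect_straightened). The bound on
    the ranks is the hypothesis on the dimension; it is also what makes every
    (1^rk) appear untruncated, so that total sizes agree.

    Rewriting stops when the support is a chain. The variable of the empty face
    equals 1 and contributes the zero partition, so it may be erased at the end,
    and what is left is standard. *)

(* The name otherwise denotes the shape of a sequence of sequences. *)
Local Notation shape := Defs.shape.

(** * Dominance order on partitions *)

Section Dominance.
Variable n : nat.
Implicit Types l m : partition_le n.

Lemma partsD l m i : (l + m) i = (l i + m i)%N.
Proof. by rewrite -[parts _]/(val (l + m)) raddfD ffunE. Qed.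

Lemma dominatedP l m :
  reflect ((\sum_(i < n) m i = \sum_(i < n) l i)%N /\
     forall j : 'I_n,
       (\sum_(i < n | (i <= j)%N) m i <= \sum_(i < n | (i <= j)%N) l i)%N)
    (dominated m l).
Proof. by apply: (iffP andP) => -[/eqP ? /forallP ?]; split. Qed.

Lemma dominated_refl l : dominated l l.
Proof. by apply/dominatedP; split. Qed.

Lemma dominated_trans l1 l2 l3 :
  dominated l1 l2 -> dominated l2 l3 -> dominated l1 l3.
Proof.
move=> /dominatedP[e12 h12] /dominatedP[e23 h23]; apply/dominatedP.
by split=> [|j]; rewrite ?e12 // (leq_trans (h12 j)).
Qed.

Lemma dominatedD l1 l2 m1 m2 :
  dominated m1 l1 -> dominated m2 l2 -> dominated (m1 + m2) (l1 + l2).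
Proof.
have sumD (A : pred 'I_n) l m :
    (\sum_(i < n | A i) (l + m)%R i =
     \sum_(i < n | A i) l i + \sum_(i < n | A i) m i)%N.
  by rewrite -big_split; apply: eq_bigr => i _; rewrite partsD.
move=> /dominatedP[e1 h1] /dominatedP[e2 h2]; apply/dominatedP.
by split=> [|j]; rewrite !sumD ?e1 ?e2 // leq_add.
Qed.

Lemma sum_ltn_ord (N q : nat) : (\sum_(i < N) nat_of_bool (i < q) = minn q N)%N.
Proof.
elim: N => [|N IH]; first by rewrite big_ord0 minn0.
by rewrite big_ord_recr /= IH; lia.
Qed.

Lemma column0 : column n 0 = 0.
Proof. by apply: val_inj; rewrite raddf0; apply/ffunP=> i; rewrite !ffunE. Qed.

(** The sum of the first j parts of (1^t) is min(t, j), which is concave in t: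
    spreading a pair of column lengths while keeping their sum can only decrease
    the partial sums. *)
Lemma dominated_columns (p q r s : nat) :
    (p <= q)%N -> (p <= r)%N -> (s <= n)%N -> (p + s = q + r)%N ->
  dominated (column n p + column n s) (column n q + column n r).
Proof.
have colE t (j : 'I_n) :
    (\sum_(i < n | (i <= j)%N) column n t i = minn t j.+1)%N.
  rewrite big_mkcond -[RHS]/(minn t j.+1) /=.
  under eq_bigr do rewrite ffunE.
  transitivity (\sum_(i < n) nat_of_bool (i < minn t j.+1))%N.
    apply: eq_bigr => i _; rewrite leq_min ltnS.
    by case: (i <= j)%N; rewrite ?andbT ?andbF.
  by rewrite sum_ltn_ord; have := ltn_ord j; lia.
have colT t : (\sum_(i < n) column n t i = minn t n)%N.
  by rewrite -sum_ltn_ord; apply: eq_bigr => i _; rewrite ffunE.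
move=> pq pr sn e; apply/dominatedP; split=> [|j].
  under eq_bigr do rewrite partsD.
  under [RHS]eq_bigr do rewrite partsD.
  by rewrite !big_split /= !colT; lia.
under eq_bigr do rewrite partsD.
under [leqRHS]eq_bigr do rewrite partsD.
by rewrite !big_split /= !colE; lia.
Qed.

End Dominance.

(** * Ranks in a boolean complex *)

Section Rank.
Variables (d : Order.disp_t) (P : finBPOrderType d).
Implicit Types a b c m : P.
Local Open Scope order_scope.

(** The map X |-> #|X| is injective on a chain of proper subsets of Z, which
    bounds the length of such a chain by #|Z|; the initial segments of an
    enumeration of Z attain the bound. *)
Lemma rk_embedding (r : nat) (f : {set 'I_r} -> P) (Z : {set 'I_r}) :
    (forall X Y, (f X <= f Y) = (X \subset Y)) ->
    (forall b, b <= f Z -> exists X, f X = b) ->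
  rk (f Z) = #|Z|%N.
Proof.
move=> fle fonto; apply/eqP; rewrite eqn_leq; apply/andP; split.
  apply/bigmax_leqP => C /andP[/forall_inP chC /forall_inP ltC].
  have [-> | [b0 b0C]] := set_0Vmem C; first by rewrite cards0.
  have /fin_all_exists[g fg] : forall b, exists X, b \in C -> f X = b.
    move=> b; case: (boolP (b \in C)) => [bC|_]; last by exists set0.
    by have [X fX] := fonto b (ltW (ltC b bC)); exists X.
  have gZ b : b \in C -> (#|g b| < #|Z|)%N.
    move=> bC; apply: proper_card.
    by rewrite properE -!fle fg // -lt_leAnge ltC.
  (* C is not empty, so neither is Z, and 'I_#|Z|.-1.+1 has #|Z| elements. *)
  have ginj : {in C &, injective (fun b => inord #|g b| : 'I_#|Z|.-1.+1)}.
    move=> a b aC bC /(congr1 val) /=.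
    rewrite !inordK ?(leq_trans (gZ _ _) (leqSpred _)) // => eab.
    rewrite -(fg a aC) -(fg b bC).
    have /orP[] := forall_inP (chC a aC) b bC;
      rewrite -{1}(fg a aC) -{1}(fg b bC) fle => sab.
      by congr f; apply/eqP; rewrite eqEcard sab eab leqnn.
    by congr f; apply/esym/eqP; rewrite eqEcard sab eab leqnn.
  rewrite -(card_in_imset ginj) (leq_trans (max_card _)) // card_ord.
  by rewrite (ltn_predK (gZ b0 b0C)).
pose T i := [set x in take i (enum Z)].
have Tle i j : (i <= j)%N -> T i \subset T j.
  by move=> ij; apply/subsetP=> x; rewrite !inE -(subnKC ij) takeD mem_cat => ->.
have cT i : (i <= #|Z|)%N -> #|T i| = i.
  move=> iZ; rewrite cardsE; have /card_uniqP-> : uniq (take i (enum Z)).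
    by rewrite take_uniq // enum_uniq.
  by rewrite size_takel // -cardE.
have TZ i : T i \subset Z.
  by apply/subsetP=> x; rewrite inE => /mem_take; rewrite mem_enum.
have finj : injective f.
  by move=> X Y e; apply/eqP; rewrite eqEsubset -!fle e lexx.
have Tinj : injective (fun i : 'I_#|Z| => f (T i)).
  move=> i j /finj /(congr1 (fun X : {set _} => #|X|)).
  by rewrite !cT; [exact: val_inj| exact: ltnW..].
rewrite -[X in (X <= _)%N]card_ord -(card_imset _ Tinj).
apply: leq_bigmax_cond; apply/andP; split.
  apply/forall_inP=> _ /imsetP[i _ ->]; apply/forall_inP=> _ /imsetP[j _ ->].
  rewrite /Order.comparable !fle.
  by case/orP: (leq_total i j) => /Tle->; rewrite ?orbT.
apply/forall_inP=> _ /imsetP[i _ ->]; rewrite lt_leAnge !fle TZ /=.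
by apply/negP=> /subset_leq_card; rewrite (cT _ (ltnW (ltn_ord i))) leqNgt ltn_ord.
Qed.

Lemma rk_bot : rk (\bot : P) = 0%N.
Proof.
apply/eqP; rewrite -leqn0; apply/bigmax_leqP => C /andP[_ /forall_inP ltC].
rewrite leqn0 cards_eq0; apply/set0Pn => -[b /ltC].
by rewrite ltx0.
Qed.

Hypothesis hP : boolean_complex P.

Lemma boolean_interval c :
  exists (r : nat) (f : {set 'I_r} -> P),
    [/\ forall X Y, (f X <= f Y) = (X \subset Y),
        forall b, b <= c -> exists X, f X = b &
        forall X, f X <= c -> rk (f X) = #|X|%N].
Proof.
have [r [f [fle fonto]]] := hP c; exists r, f; split=> // [b|X Xc].
  exact: (fonto b).1.
by apply: rk_embedding => // b bX; apply: (fonto b).1; apply: le_trans Xc.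
Qed.

Lemma boolean_meet a b c : common_ub a b c -> exists m, is_meet a b m.
Proof.
move=> /andP[ac bc]; have [r [f [fle fonto _]]] := boolean_interval c.
have [X fX] := fonto a ac; have [Y fY] := fonto b bc.
exists (f (X :&: Y)); rewrite /is_meet -fX -fY !fle subsetIl subsetIr /=.
apply/forallP=> m; apply/implyP=> /andP[ma mb].
have [|W fW] := fonto m; first by rewrite (le_trans ma) // fX.
by move: ma mb; rewrite -fW !fle subsetI => -> ->.
Qed.

Lemma rk_lt a b : a < b -> (rk a < rk b)%N.
Proof.
have [r [f [fle fonto frk]]] := boolean_interval b => ab.
have [X fX] := fonto a (ltW ab); have [Y fY] := fonto b (lexx b).
rewrite -fX -fY !frk ?fX ?fY ?(ltW ab) //.
by apply: proper_card; rewrite properE -!fle fX fY -lt_leAnge.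
Qed.

Lemma rk_le a b : a <= b -> (rk a <= rk b)%N.
Proof. by rewrite le_eqVlt => /orP[/eqP->|/rk_lt/ltnW]. Qed.

(** In the boolean interval below c, the faces m and c are the meet and the join
    of a and b, so this is #|X :&: Y| + #|X :|: Y| = #|X| + #|Y|. *)
Lemma rk_modular a b c m :
  min_common_ub a b c -> is_meet a b m -> (rk m + rk c = rk a + rk b)%N.
Proof.
move=> /andP[/andP[ac bc] /forallP cmin] /andP[/andP[ma mb] /forallP mmax].
have mc := le_trans ma ac; have [r [f [fle fonto frk]]] := boolean_interval c.
have [X fX] := fonto a ac; have [Y fY] := fonto b bc.
have [W fW] := fonto m mc; have [Z fZ] := fonto c (lexx c).
have WXY : W = X :&: Y.
  apply/eqP; rewrite eqEsubset subsetI -!fle fW fX fY ma mb /=.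
  have := mmax (f (X :&: Y)).
  by rewrite -{1}fX -{1}fY !fle subsetIl subsetIr.
have ZXY : Z = X :|: Y.
  have sXYZ : X :|: Y \subset Z by rewrite subUset -!fle fX fY fZ ac bc.
  have := cmin (f (X :|: Y)); rewrite /common_ub -{1}fX -{1}fY !fle.
  rewrite subsetUl subsetUr -fZ fle sXYZ /= => /eqP e.
  by apply/eqP; rewrite eqEsubset sXYZ -!fle e lexx.
rewrite -fX -fY -fW -fZ !frk ?fX ?fY ?fW ?fZ //.
by rewrite WXY ZXY addnC cardsUI.
Qed.

Lemma rk_le_dim (n : nat) a : complex_dim P = (n%:Z - 1)%R -> (rk a <= n)%N.
Proof.
move=> hdim; have : face_dim a <= complex_dim P by apply: le_bigmax.
by rewrite hdim /face_dim; lia.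
Qed.

End Rank.

(** * Monomials and the straightening relation *)

Section Monomials.
Variables (k : fieldType) (d : Order.disp_t) (P : finBPOrderType d).
Implicit Types (a b m : P) (c e : {ffun P -> nat}).

Definition single a : {ffun P -> nat} := [ffun x => (x == a) : nat].

Lemma monomialD c e : monomial k (c + e) = monomial k c * monomial k e.
Proof.
rewrite /monomial -rmorphM; congr face_class.
by under eq_bigr do rewrite ffunE exprD; rewrite big_split.
Qed.

Lemma monomial_single a : monomial k (single a) = face_class (face_var k a).
Proof.
rewrite /monomial (bigD1 a) //= ffunE eqxx expr1 big1 ?mulr1 // => b ba.
by rewrite ffunE (negbTE ba) expr0.
Qed.

Lemma face_class_relation p : @face_relation k d P p -> face_class p = 0.
Proof.
move=> hp; rewrite -(raddf0 (@face_class k d P)); apply/eqP.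
rewrite /face_class -[_ == _]/(_ == _ %[mod {ideal_quot (@face_ideal k d P)}])%qT.
rewrite -Quotient.idealrBE subr0; apply/asboolP; exists [:: (1, p)].
by split=> [u|]; rewrite ?inE ?big_seq1 ?mul1r // => /eqP->.
Qed.

Lemma monomial_bot : monomial k (single \bot%O) = 1.
Proof.
rewrite monomial_single; apply/eqP; rewrite -subr_eq0.
rewrite -(rmorph1 (@face_class k d P)) -rmorphB; apply/eqP.
by apply: face_class_relation; constructor 1.
Qed.

(** The two kinds of straightening relations in one formula: without a common
    upper bound the sum is empty, and m is arbitrary. *)
Lemma straighten_pair (hP : boolean_complex P) a b :
  exists m,
    monomial k (single a + single b) =
      \sum_(u | min_common_ub a b u) monomial k (single m + single u) /\
    forall u, min_common_ub a b u -> is_meet a b m.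
Proof.
rewrite monomialD !monomial_single -rmorphM.
have [/existsP[u0 ubu0]|/existsPn noub] := boolP [exists u, common_ub a b u].
  have [m hm] := boolean_meet hP ubu0; exists m; split=> //.
  under eq_bigr do rewrite monomialD !monomial_single.
  rewrite -mulr_sumr -raddf_sum -rmorphM; apply/eqP; rewrite -subr_eq0 -raddfB.
  apply/eqP/face_class_relation; constructor 3.
  by exists a, b, m; split=> //; exists u0.
exists \bot%O; split=> [|u /andP[ub_u]]; last by rewrite (negbTE (noub u)) in ub_u.
rewrite big_pred0 => [|u]; last by rewrite /min_common_ub (negbTE (noub u)).
by apply: face_class_relation; constructor 2; exists a, b.
Qed.

Section Shape.
Variable n : nat.

Lemma shapeD c e : shape n (c + e) = shape n c + shape n e.
Proof. by rewrite -big_split; apply: eq_bigr => a _; rewrite ffunE mulrnDr. Qed.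

Lemma shape_single a : shape n (single a) = column n (rk a).
Proof.
have [->|a0] := eqVneq a \bot%O.
  rewrite rk_bot column0 /shape big1 // => b /negbTE b0.
  by rewrite ffunE b0.
rewrite /shape (bigD1 a) //= ffunE eqxx big1 ?addr0 // => b /andP[_ /negbTE ba].
by rewrite ffunE ba.
Qed.

(** The termination measure of straightening: r * (n - r) is strictly concave in
    r, so spreading two ranks apart with constant sum makes it drop. *)
Definition height_defect c : nat := (\sum_(a : P) c a * (rk a * (n - rk a)))%N.

Lemma height_defectD c e :
  height_defect (c + e) = (height_defect c + height_defect e)%N.
Proof. by rewrite -big_split; apply: eq_bigr => a _; rewrite ffunE mulnDl. Qed.

Lemma height_defect_single a :
  height_defect (single a) = (rk a * (n - rk a))%N.
Proof.
rewrite /height_defect (bigD1 a) //= ffunE eqxx mul1n big1 ?addn0 // => b ba.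
by rewrite ffunE (negbTE ba).
Qed.

End Shape.

Lemma not_chainP c :
  ~~ is_chain [set a | c a != 0%N] ->
  exists a b e, ~~ (a >=< b)%O /\ c = e + (single a + single b).
Proof.
case/forall_inPn=> a; rewrite inE => ca /forall_inPn[b]; rewrite inE => cb ab.
exists a, b, [ffun x => c x - (x == a) - (x == b)]%N; split=> //.
apply/ffunP=> x; rewrite !ffunE !natrDE.
have [xa|xa] := eqVneq x a; have [xb|xb] := eqVneq x b.
- by move: ab; rewrite -xa -xb comparablexx.
- by move: ca; rewrite -xa; case: (c x) => // q _; rewrite /= subn0 subn1 ?addn0 ?add0n addn1.
- by move: cb; rewrite -xb; case: (c x) => // q _; rewrite /= subn0 subn1 ?addn0 ?add0n addn1.
- by rewrite /= !subn0 !addn0.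
Qed.

End Monomials.

(** * Straightening arbitrary monomials *)

Section Straightening.
Variables (k : fieldType) (d : Order.disp_t) (P : finBPOrderType d) (n : nat).
Implicit Types (l : partition_le n) (f g : face_ring k P).

(** Linear combinations are lists of coefficients and exponent vectors, possibly
    with repeated vectors: concatenation is then addition, and vectors are
    collected by shape only once, in dominated_span_in_sum. *)
Definition dominated_span l f : Prop :=
  exists s : seq (k * {ffun P -> nat}),
    (forall u, u \in s -> standard u.2 /\ dominated (shape n u.2) l) /\
    f = \sum_(u <- s) u.1 *: monomial k u.2.

Lemma dominated_spanW l l' f :
  dominated l l' -> dominated_span l f -> dominated_span l' f.
Proof.
move=> ll' [s [hs ->]]; exists s; split=> // u /hs[? ul]; split=> //.
exact: dominated_trans ll'.
Qed.

Lemma dominated_span_sum l (I : eqType) (r : seq I) (A : pred I)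
    (F : I -> face_ring k P) :
  (forall i, i \in r -> A i -> dominated_span l (F i)) ->
  dominated_span l (\sum_(i <- r | A i) F i).
Proof.
move=> hF; rewrite big_seq_cond; apply: big_ind => [|f g|i /andP[]]; last exact: hF.
  by exists [::]; rewrite big_nil.
move=> [s [hs ->]] [t [ht ->]]; exists (s ++ t); rewrite big_cat; split=> // u.
by rewrite mem_cat => /orP[/hs|/ht].
Qed.

Lemma dominated_spanZ l x f : dominated_span l f -> dominated_span l (x *: f).
Proof.
move=> [s [hs ->]]; exists [seq (x * u.1, u.2) | u <- s]; split.
  by move=> _ /mapP[u us ->]; have [] := hs u us.
by rewrite big_map scaler_sumr; apply: eq_bigr => u _; rewrite scalerA.
Qed.

Lemma dominated_span_standard c :
  standard c -> dominated_span (shape n c) (monomial k c).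
Proof.
move=> sc; exists [:: (1, c)]; rewrite big_seq1 scale1r; split=> // u.
by rewrite inE => /eqP->; split=> //; apply: dominated_refl.
Qed.

Lemma sum_fibres (V : zmodType) (I J : eqType) (p : I -> J) (s : seq I)
    (F : I -> V) :
  \sum_(i <- s) F i = \sum_(j <- undup (map p s)) \sum_(i <- s | p i == j) F i.
Proof.
rewrite (exchange_big_dep predT) //= big_seq [RHS]big_seq.
apply: eq_bigr => i si; under eq_bigl do rewrite eq_sym.
rewrite -big_filter filter_pred1_uniq ?undup_uniq ?mem_undup ?map_f //.
by rewrite big_seq1.
Qed.

(** The list is grouped by shape, and within one shape by exponent vector, so
    that repeated vectors get a single coefficient. *)
Lemma dominated_span_in_sum l f :
  dominated_span l f ->
  in_sum (fun m : partition_le n => dominated m l)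
    (fun m => @shape_component k d P n m) f.
Proof.
move=> [s [hs ->]]; pose sh (u : k * {ffun P -> nat}) := shape n u.2.
exists (undup (map sh s)).
exists (fun m => \sum_(u <- s | sh u == m) u.1 *: monomial k u.2).
split; [exact: undup_uniq | | exact: sum_fibres].
move=> m; rewrite mem_undup => /mapP[u us ->]; split; first by have [] := hs u us.
set t := [seq v <- s | sh v == sh u].
exists (undup (map snd t)), (fun c => \sum_(v <- t | v.2 == c) v.1); split.
  move=> c; rewrite mem_undup => /mapP[v]; rewrite mem_filter => /andP[/eqP e vs] ->.
  by have [] := hs v vs.
rewrite -big_filter -/t (sum_fibres snd); apply: eq_bigr => c _.
by rewrite scaler_suml; apply: eq_bigr => v /eqP->.
Qed.

Hypotheses (hP : boolean_complex P) (hdim : complex_dim P = n%:Z - 1).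

Lemma height_defect_straightened (a b c m : P) :
    ~~ (a >=< b)%O -> min_common_ub a b c -> is_meet a b m ->
  (height_defect n (single m + single c)%R <
   height_defect n (single a + single b)%R)%N.
Proof.
move=> ab hc hm; rewrite !height_defectD !height_defect_single.
have e := rk_modular hP hc hm; have cn := rk_le_dim c hdim.
have /andP[/andP[ma mb] _] := hm.
have lma : (rk m < rk a)%N.
  apply/(rk_lt hP); rewrite lt_neqAle ma andbT; apply: contra ab => /eqP <-.
  by rewrite /Order.comparable mb.
have lmb : (rk m < rk b)%N.
  apply/(rk_lt hP); rewrite lt_neqAle mb andbT; apply: contra ab => /eqP <-.
  by rewrite /Order.comparable ma orbT.
nia.
Qed.

Lemma shape_straightened (a b c m : P) :
  min_common_ub a b c -> is_meet a b m ->
  dominated (shape n (single m + single c)) (shape n (single a + single b)).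
Proof.
move=> hc hm; rewrite !shapeD !shape_single.
have /andP[/andP[ma mb] _] := hm.
by apply: dominated_columns;
  rewrite ?(rk_le hP) ?(rk_le_dim c hdim) ?(rk_modular hP hc hm).
Qed.

(** Induction on the height defect, straightening one incomparable pair at a
    time until the support is a chain. *)
Lemma dominated_span_monomial c :
  dominated_span (shape n c) (monomial k c).
Proof.
have [N] := ubnP (height_defect n c); elim: N c => // N IH c; rewrite ltnS => cN.
have [chc|/not_chainP[a [b [e [ab ce]]]]] :=
    boolP (is_chain [set a | c a != 0%N]); last first.
  have [m [ab_m hm]] := straighten_pair k hP a b.
  rewrite {2}ce monomialD ab_m mulr_sumr.
  apply: dominated_span_sum => g _ hg; rewrite -monomialD.
  apply: (@dominated_spanW (shape n (e + (single m + single g)))).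
    rewrite ce !(shapeD n e) dominatedD ?dominated_refl //.
    exact: shape_straightened hg (hm g hg).
  apply: IH; apply: leq_trans cN.
  rewrite ce !(height_defectD n e) ltn_add2l.
  exact: height_defect_straightened ab hg (hm g hg).
(* The support is a chain, but it may still contain the empty face. *)
pose c' : {ffun P -> nat} := [ffun x => if x == \bot%O then 0%N else c x].
have -> : monomial k c = monomial k c'.
  have cE : c = c' + single \bot%O *+ c \bot%O.
    apply/ffunP=> x; rewrite !ffunE ffunMnE ffunE.
    by case: eqVneq => [->|_]; rewrite ?mul0rn ?addr0 // add0r natn.
  rewrite cE monomialD; elim: (c _) => [|q IHq]; last first.
    by rewrite mulrSr monomialD mulrA IHq monomial_bot mulr1.
  by rewrite -monomialD addr0.
have -> : shape n c = shape n c'.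
  by apply: eq_bigr => a /negbTE a0; rewrite ffunE a0.
apply: dominated_span_standard; rewrite /standard ffunE eqxx /=.
apply/forall_inP=> a; rewrite inE ffunE; case: ifP => // _ ca.
apply/forall_inP=> b; rewrite inE ffunE; case: ifP => // _ cb.
by apply: (forall_inP (forall_inP chc a _)); rewrite inE.
Qed.

End Straightening.

Theorem proposition3p17
  (d : Order.disp_t) (P : finBPOrderType d) (n : nat) (k : fieldType)
  (hP : boolean_complex P) (hdim : complex_dim P = n%:Z - 1)
  (l1 l2 : partition_le n) (f1 f2 : face_ring k P)
  (hf1 : shape_component l1 f1) (hf2 : shape_component l2 f2) :
  in_sum (fun m : partition_le n => dominated m (l1 + l2))
    (fun m => @shape_component k d P n m) (f1 * f2).
Proof.
have [s1 [a1 [h1 ->]]] := hf1; have [s2 [a2 [h2 ->]]] := hf2.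
apply: dominated_span_in_sum; rewrite mulr_suml.
apply: dominated_span_sum => c1 /h1[_ <-] _; rewrite mulr_sumr.
apply: dominated_span_sum => c2 /h2[_ <-] _.
rewrite -scalerAl [monomial k c1 * _]mulrC -scalerAl -monomialD addrC -shapeD.
by apply/dominated_spanZ/dominated_spanZ/dominated_span_monomial.
Qed.
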